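(* Let $k\ge 2$ and $n>2k$ be integers such that $k$ does not divide $n$. Then $$\rho(\mathrm{PX}(n,k))=\begin{cases}\lceil n/k\rceil+1, & \text{if } n\equiv -1\pmod k,\\ \lceil n/k\rceil, & \text{if } n\not\equiv -1\pmod k.\end{cases}$$
   Context: For integers $n\ge 3$ and $1\le k<n$, the Praeger–Xu graph $\mathrm{PX}(n,k)$ is the simple graph with vertex set $\mathbb Z_n\times\mathbb Z_2^k$; a vertex is written $(i,x)$ with $x=x_0x_1\cdots x_{k-1}$ a bitstring of length $k$. Two vertices $(i,x)$ and $(j,y)$ are adjacent if and only if (after possibly swapping the two vertices) $j=i+1$ in $\mathbb Z_n$ and $x=az_1\cdots z_{k-1}$, $y=z_1\cdots z_{k-1}b$ for some bits $a,b,z_1,\dots,z_{k-1}\in\mathbb Z_2$. For a graph $G$ admitting a 2-coloring of its vertices preserved (class-wise) only by the identity automorphism, $\rho(G)$ denotes the minimum size of a color class over all such 2-colorings. *)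

(* Defs.v *)
From HB Require Import structures.
From mathcomp Require Import all_boot all_order all_fingroup all_algebra.

Set Implicit Arguments.
Unset Strict Implicit.
Unset Printing Implicit Defensive.

Import Order.TTheory GRing.Theory Num.Theory.

Local Open Scope ring_scope.

Record sgraph := SGraph {
  vertex :> finType;
  adj : rel vertex;
  adj_sym : symmetric adj;
  adj_irr : irreflexive adj
}.

Section Cost.

Variable G : sgraph.

Definition is_aut (s : {perm G}) : bool :=
  [forall u : G, forall v : G, adj (s u) (s v) == adj u v].

Definition coloring := {ffun G -> bool}.

Definition color_class (c : coloring) (b : bool) : {set G} :=
  [set v | c v == b].

(* Each class is preserved separately: swapping the colors is not allowed. *)
Definition preserves (s : {perm G}) (c : coloring) : bool :=
  [forall b : bool, s @: color_class c b == color_class c b].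

Definition distinguishing (c : coloring) : bool :=
  [forall s : {perm G}, is_aut s && preserves s c ==> (s == 1%g)].

Definition two_distinguishable : bool := [exists c, distinguishing c].

Definition is_class_size (m : nat) : bool :=
  [exists c, distinguishing c && [exists b, #|color_class c b| == m]].

Lemma ex_class_size : two_distinguishable -> exists m, is_class_size m.
Proof.
case/existsP=> c dc; exists #|color_class c true|; apply/existsP; exists c.
by rewrite dc; apply/existsP; exists true.
Qed.

(* Defined only for graphs admitting a distinguishing 2-coloring; the witness
   is irrelevant, since it proves a boolean statement. *)
Definition rho (h : two_distinguishable) : nat := ex_minn (ex_class_size h).

End Cost.

Section PraegerXu.

(* 'Z_n is the ring of integers mod n only for n > 1; the graph is meant for
   n >= 3 and 1 <= k < n. *)
Variables n k : nat.

Definition PX_vertex : finType := ('Z_n * k.-tuple 'Z_2)%type.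

Definition PX_arc (u v : PX_vertex) : bool :=
  (v.1 == u.1 + 1) &&
  [exists a : 'Z_2, exists b : 'Z_2, exists z : k.-1.-tuple 'Z_2,
     (u.2 == a :: z :> seq 'Z_2) && (v.2 == rcons z b :> seq 'Z_2)].

Definition PX_adj : rel PX_vertex := fun u v => PX_arc u v || PX_arc v u.

Lemma PX_adj_sym : symmetric PX_adj.
Proof. by move=> u v; rewrite /PX_adj orbC. Qed.

Lemma PX_adj_irr : irreflexive PX_adj.
Proof.
move=> u; rewrite /PX_adj orbb /PX_arc -[X in X == _]addr0.
by rewrite (inj_eq (addrI _)) eq_sym oner_eq0.
Qed.

Definition PX : sgraph := SGraph PX_adj_sym PX_adj_irr.

End PraegerXu.

(* Main.v *)
(* Read the vertex (i, x) of PX(n, k) as the word x written on the window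
   [i, i + k) of Z_n, so that adjacent vertices have shifted windows and agree
   on the overlap.  For n >= 5 two neighbours of v lying on opposite sides of v
   have no other common neighbour, while two on the same side do; hence an
   automorphism preserves all arcs or reverses all of them, and acts on window
   starts by i -> i + c or i -> c - i.  Moreover the bit of the image at a
   position depends only on the bit of the vertex at the corresponding position.

   Lower bound: flipping the bit at one position is an automorphism that fixes
   every vertex not covering it, so the windows of a color class must cover
   Z_n.  If n = mk - 1 and the class has m elements, then exactly one position
   is covered twice, and the reflection about it, corrected by bit flips,
   preserves the class.

   Upper bound: write n = qk + r and take the zero words at k, 2k, ..., qk
   together with 10...0 at 0.  The only nontrivial dihedral symmetry of the
   starts swaps 0 and qk; when the two windows overlap in at least two positions
   (r < k - 1), it carries a position where the words agree to one where they
   differ.  When r = k - 1, adding the zero word at 0 makes the fibre over 0 the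
   only one with two elements. *)
Require Import Defs.
From mathcomp Require Import all_boot all_order all_fingroup all_algebra.
From mathcomp Require Import zify ring.
Set Implicit Arguments.
Unset Strict Implicit.
Unset Printing Implicit Defensive.
Import Order.TTheory GRing.Theory Num.Theory.
Local Open Scope ring_scope.

Lemma preservesP (G : sgraph) (s : {perm G}) (c : coloring G) :
  reflect (forall u, c (s u) = c u) (preserves s c).
Proof.
apply: (iffP forallP) => [sc u | sc b].
  have: s u \in s @: color_class c (c u) by rewrite imset_f ?inE.
  by rewrite (eqP (sc (c u))) inE => /eqP.
apply/eqP/setP=> v; rewrite inE -{2}(permKV s v) sc.
by rewrite -{1}(permKV s v) mem_imset ?inE //; apply: perm_inj.
Qed.

Lemma is_autP (G : sgraph) (s : {perm G}) :
  reflect (forall u v, adj (s u) (s v) = adj u v) (is_aut s).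
Proof.
apply: (iffP forallP) => [h u v | h u]; first by have /forallP/(_ v)/eqP := h u.
by apply/forallP=> v; rewrite h.
Qed.

Lemma is_autV (G : sgraph) (s : {perm G}) : is_aut s -> is_aut (s^-1)%g.
Proof. by move/is_autP=> sP; apply/is_autP=> u v; rewrite -sP !permKV. Qed.

Lemma Z2_eq (a b c : 'Z_2) : (a == c) = (b == c) -> a = b.
Proof.
by case: a b c => [[|[|?]] ?] [[|[|?]] ?] [[|[|?]] ?] // _; apply: val_inj.
Qed.

(** * Vertices as words on windows of Z_n *)

Section Windows.

Variables n k : nat.
Hypotheses (k_ge2 : (2 <= k)%N) (ltkn : (2 * k < n)%N).

Implicit Types (p q i j : 'Z_n) (u v : PX_vertex n k) (w : 'Z_n -> 'Z_2).

Let n_gt1 : (1 < n)%N. Proof. lia. Qed.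

(** Number of steps forward around the cycle from [i] to [p]; when below [k], the index of [p] in
    the window starting at [i]. *)
Definition off p i : nat := nat_of_ord (p - i).

Arguments off (p i)%_R.

Lemma off_lt p i : (off p i < n)%N.
Proof. by rewrite /off -[X in (_ < X)%N](Zp_cast n_gt1) ltn_ord. Qed.

Lemma offK p i : i + (off p i)%:R = p.
Proof. by rewrite natr_Zp addrC subrK. Qed.

Lemma off_add i d : (d < n)%N -> off (i + d%:R) i = d.
Proof. by move=> dn; rewrite /off addrAC subrr add0r val_Zp_nat // modn_small. Qed.

Lemma off_eq p i d : (d < n)%N -> p = i + d%:R -> off p i = d.
Proof. by move=> dn ->; apply: off_add. Qed.

Lemma eq_natZ a b : (a%:R == b%:R :> 'Z_n) = (a == b %[mod n])%N.
Proof.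
apply/eqP/eqP=> [/(congr1 (@nat_of_ord _)) | ab]; first by rewrite !val_Zp_nat.
by apply: val_inj; rewrite /= !val_Zp_nat.
Qed.

Definition cov p u : bool := (off p u.1 < k)%N.

(* The value is 0 when the window of [u] does not contain [p]. *)
Definition bit p u : 'Z_2 := nth 0 u.2 (off p u.1).

(** The word [w] lives on all of Z_n, so moving the start while keeping [w] walks along arcs. *)
Definition win i w : PX_vertex n k := (i, [tuple w (i + (val j)%:R) | j < k]).

Lemma bit_win p i w : (off p i < k)%N -> bit p (win i w) = w p.
Proof.
move=> h; rewrite /bit /= (nth_map (Ordinal h)) ?size_enum_ord //.
by rewrite nth_enum_ord // offK.
Qed.

Lemma vertex_eq u v :
  u.1 = v.1 -> (forall p, cov p u -> bit p u = bit p v) -> u = v.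
Proof.
case: u v => [i x] [j y] /= <- h; congr pair; apply: eq_from_tnth => a.
have an : (a < n)%N by have := ltn_ord a; lia.
have := h (i + (val a)%:R); rewrite /cov /bit /= off_add // ltn_ord => /(_ isT).
by rewrite -!tnth_nth.
Qed.

Lemma eq_win i w w' :
  (forall p, (off p i < k)%N -> w p = w' p) -> win i w = win i w'.
Proof. by move=> h; apply: vertex_eq => // p cp; rewrite !bit_win ?h. Qed.

Lemma win_bit u : win u.1 (bit^~ u) = u.
Proof. by apply: vertex_eq => // p cp; rewrite bit_win. Qed.

Lemma arcP u v :
  reflect (v.1 = u.1 + 1 /\ forall p, cov p u -> cov p v -> bit p u = bit p v)
          (PX_arc u v).
Proof.
rewrite /PX_arc; case: u v => [i x] [j y] /=.
have k1 : (k.-1.+1 = k)%N by lia.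
apply: (iffP andP) => [[/eqP -> /existsP[a /existsP[b /existsP[z]]]] | [-> h]].
  case/andP=> /eqP xz /eqP yz; split=> // p; rewrite /cov /bit /= => cu cv.
  rewrite xz yz.
  (* A common position has index one larger in the earlier window. *)
  have e : (off p i = (off p (i + 1)).+1)%N.
    by apply: off_eq; [lia | rewrite -{1}(offK p (i + 1)); ring].
  by rewrite e /= nth_rcons size_tuple -ltnS k1 -e cu.
split=> //; apply/existsP; exists (nth 0 x 0).
apply/existsP; exists (nth 0 y k.-1).
have sz : size (behead x) == k.-1 by rewrite size_behead size_tuple.
apply/existsP; exists (Tuple sz); rewrite /=; apply/andP; split.
  case: x {h} sz => -[|a x] //= sx _; exfalso; move/eqP: sx => /=; lia.
apply/eqP; apply: (@eq_from_nth _ 0) => [|m].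
  by rewrite size_rcons (eqP sz) size_tuple.
rewrite size_tuple => mk.
rewrite nth_rcons (eqP sz); case: ltngtP => [mk1||->] //; last by lia.
have := h (i + 1 + m%:R); rewrite /cov /bit /=.
have -> : i + 1 + m%:R = i + m.+1%:R by ring.
rewrite off_add; last by lia.
have -> : i + m.+1%:R = i + 1 + m%:R by ring.
rewrite off_add; last by lia.
by rewrite nth_behead => -> //; lia.
Qed.

Lemma arc_win i w : PX_arc (win i w) (win (i + 1) w).
Proof. by apply/arcP; split=> // p c1 c2; rewrite !bit_win. Qed.

Lemma adj_bit u v p :
  PX_adj u v -> cov p u -> cov p v -> bit p u = bit p v.
Proof. by case/orP=> /arcP[_ h] cu cv; rewrite h. Qed.

(* As 2k <= n, walking from start 0 to start k forgets all the bits of [u]. *)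
Lemma arc_const (T : Type) (F : PX_vertex n k -> T) :
  (forall u v, PX_arc u v -> F u = F v) -> forall u v, F u = F v.
Proof.
move=> hF.
have step i w m : F (win i w) = F (win (i + m%:R) w).
  elim: m => [|m ->]; first by rewrite addr0.
  by rewrite (hF _ _ (arc_win _ w)) -addrA -natr1.
suff all0 u : F u = F (win k%:R (fun=> 0)) by move=> u v; rewrite !all0.
rewrite -[u]win_bit; set w := bit^~ u.
rewrite (step _ _ (off 0 u.1)) offK.
rewrite (@eq_win _ _ (fun p => if (off p 0 < k)%N then w p else 0)); last first.
  by move=> p ->.
rewrite (step _ _ k) add0r; congr F; apply: eq_win => p pk.
rewrite -(offK p k%:R) -[k%:R + _]add0r -natrD off_add; last by lia.
by rewrite ltnNge leq_addr.
Qed.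

(* The vertices covering [p] with a given bit at [p] are connected by arcs. *)
Lemma bit_dep (T : Type) (F : PX_vertex n k -> T) p :
    (forall u v, PX_arc u v -> cov p u -> cov p v -> F u = F v) ->
  forall u v, cov p u -> cov p v -> bit p u = bit p v -> F u = F v.
Proof.
move=> hF.
have offp m : (m < k)%N -> off p (p - m%:R) = m.
  by move=> mk; apply: off_eq; [lia | rewrite subrK].
have step w m : (m < k)%N -> F (win (p - m%:R) w) = F (win p w).
  elim: m => [|m IH] mk; first by rewrite subr0.
  rewrite -IH; last by lia.
  have e : p - m%:R = p - m.+1%:R + 1 by ring.
  by rewrite e; apply: hF; rewrite ?arc_win // /cov /= -?e offp //; lia.
suff all0 u : cov p u ->
    F u = F (win (p - k.-1%:R) (fun x => if x == p then bit p u else 0)).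
  by move=> u v cu cv e; rewrite (all0 u) // (all0 v) // e.
move=> cu; rewrite -[in LHS](win_bit u).
have {1}-> : u.1 = p - (off p u.1)%:R by rewrite -{1}(offK p u.1) addrK.
rewrite step //.
rewrite (@eq_win _ _ (fun x => if (off x p < k)%N then bit x u else 0)); last first.
  by move=> x ->.
rewrite -(step _ k.-1); last by lia.
congr F; apply: eq_win => x xk.
have [->|xp] := eqVneq x p.
  by rewrite (@off_eq p p 0) ?addr0 ?ifT //; lia.
set d := off x _ in xk.
have dk : d != k.-1.
  by apply: contraNneq xp => e; rewrite -(offK x (p - k.-1%:R)) -/d e subrK.
rewrite (@off_eq _ _ (n - k.-1 + d)) ?ifF //; try lia.
rewrite -{1}(offK x (p - k.-1%:R)) -/d natrD natrB; last by lia.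
have -> : n%:R = 0 :> 'Z_n by rewrite pchar_Zp.
by rewrite add0r addrA.
Qed.

(** * Automorphisms *)

(** [y] must start where [v] does, and since [k >= 2] each position of [v] is also covered by [u] or
    [w], with which both [v] and [y] agree. *)
Lemma common_nbr u v (w y : PX_vertex n k) :
  PX_arc u v -> PX_arc v w -> PX_adj y u -> PX_adj y w -> y = v.
Proof.
move=> uv vw yu yw.
have nz m : (0 < m < n)%N -> m%:R != 0 :> 'Z_n.
  by move=> /andP[m0 mn]; rewrite (eq_natZ m 0) mod0n modn_small // -lt0n.
have e : y.1 = v.1.
  (* The wrong orientations of the edges at [y] would make 2 or 4 vanish in Z_n, but
     [n > 2k >= 4]. *)
  have n2 : (2%:R : 'Z_n) != 0 by apply: nz; lia.
  have n4 : (4%:R : 'Z_n) != 0 by apply: nz; lia.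
  case/arcP: uv => vu _; case/arcP: vw => wv _.
  case/orP: yu => /arcP[h1 _]; case/orP: yw => /arcP[h2 _].
  - by case/eqP: n2; rewrite -(subrr w.1) {1}wv vu h1 h2; ring.
  - by case/eqP: n4; rewrite -(subrr y.1) {1}h2 wv vu h1; ring.
  - by rewrite h1 vu.
  - by case/eqP: n2; rewrite -(subrr y.1) {1}h2 wv vu h1; ring.
apply: vertex_eq => // p cy.
case/arcP: (uv) => vu _; case/arcP: (vw) => wv _.
have cv : cov p v by rewrite /cov -e.
have pv := cv; rewrite /cov in pv.
have [d1|d1] := boolP ((off p v.1).+1 < k)%N.
  have cu : cov p u.
    rewrite /cov (@off_eq _ _ (off p v.1).+1) //; first by lia.
    by rewrite -{1}(offK p v.1) vu; ring.
  by rewrite (adj_bit yu) // (@adj_bit u v) // /PX_adj uv.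
have cw : cov p w.
  rewrite /cov (@off_eq _ _ (off p v.1).-1); [lia| |].
    by have := off_lt p v.1; lia.
  rewrite -{1}(offK p v.1) wv -addrA nat1r prednK //; lia.
by rewrite (adj_bit yw) // -(@adj_bit v w) // /PX_adj vw.
Qed.

Lemma flip_neq v p : cov p v ->
  win v.1 (fun x => if x == p then bit p v + 1 else bit x v) != v.
Proof.
move=> cv; apply/eqP=> /(congr1 (bit p)); rewrite bit_win // eqxx => /eqP.
by rewrite -subr_eq0 addrAC subrr add0r oner_eq0.
Qed.

(** Flip the last bit of [v]: no in-neighbour of [v] covers its position. *)
Lemma in_nbrs_common u u' v : PX_arc u v -> PX_arc u' v ->
  exists2 y, y != v & PX_adj y u && PX_adj y u'.
Proof.
set p := v.1 + k.-1%:R => uv uv'.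
have op : off p v.1 = k.-1 by apply: off_add; lia.
have cp : cov p v by rewrite /cov op; lia.
exists (win v.1 (fun x => if x == p then bit p v + 1 else bit x v)).
  exact: flip_neq.
have ok x : PX_arc x v ->
  PX_arc x (win v.1 (fun x => if x == p then bit p v + 1 else bit x v)).
  case/arcP=> e h; apply/arcP; split=> // z cx cz; rewrite bit_win // ifF ?h //.
  apply: contraTF cx => /eqP ->; rewrite /cov (@off_eq _ _ k) ?ltnn; try lia.
  by rewrite /p e -[X in _ = _ + X%:R]prednK; [ring | lia].
by rewrite /PX_adj !ok // !orbT.
Qed.

(** Flip the first bit of [v]: no out-neighbour of [v] covers its position. *)
Lemma out_nbrs_common u u' v : PX_arc v u -> PX_arc v u' ->
  exists2 y, y != v & PX_adj y u && PX_adj y u'.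
Proof.
set p := v.1 => uv uv'.
have op : off p v.1 = 0%N by apply: off_eq; [lia | rewrite addr0].
have cp : cov p v by rewrite /cov op; lia.
exists (win v.1 (fun x => if x == p then bit p v + 1 else bit x v)).
  exact: flip_neq.
have ok x : PX_arc v x ->
  PX_arc (win v.1 (fun x => if x == p then bit p v + 1 else bit x v)) x.
  case/arcP=> e h; apply/arcP; split=> // z cz cx; rewrite bit_win // ifF ?h //.
  apply: contraTF cx => /eqP ->; rewrite /cov (@off_eq _ _ n.-1); try lia.
  by rewrite e /p -addrA nat1r prednK ?pchar_Zp ?addr0 //; lia.
by rewrite /PX_adj !ok.
Qed.

Lemma aut_fst (s : {perm PX n k}) : is_aut s ->
  exists c, (forall u, (s u).1 = u.1 + c) \/ (forall u, (s u).1 = c - u.1).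
Proof.
move=> /is_autP sP0.
have sP u v : PX_adj (s u) (s v) = PX_adj u v by exact: sP0.
have sadj u v : PX_arc u v -> PX_adj (s u) (s v).
  by move=> uv; rewrite sP /PX_adj uv.
(* Otherwise [s u] and [s w] lie on the same side of [s v] and share another neighbour, whose
   preimage contradicts [common_nbr]. *)
have path u v (w : PX_vertex n k) : PX_arc u v -> PX_arc v w ->
    PX_arc (s u) (s v) = PX_arc (s v) (s w).
  move=> uv vw; have no y : y != s v -> PX_adj y (s u) && PX_adj y (s w) -> False.
    move=> yv /andP[]; rewrite -{1 2}(permKV s y) (sP _ u) (sP _ w) => yu yw.
    by case/eqP: yv; rewrite -{1}(permKV s y) (common_nbr uv vw yu yw).
  apply/idP/idP => a.
    case/orP: (sadj _ _ vw) => // b.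
    by have [y] := in_nbrs_common a b => /no.
  case/orP: (sadj _ _ uv) => // b.
  by have [y] := out_nbrs_common b a => /no.
pose nx u := win (u.1 + 1) (bit^~ u); pose pv u := win (u.1 - 1) (bit^~ u).
have nxP u : PX_arc u (nx u) by rewrite -{1}(win_bit u) arc_win.
have pvP u : PX_arc (pv u) u.
  by have := arc_win (u.1 - 1) (bit^~ u); rewrite subrK win_bit.
(* Whether [s] keeps the direction of the arcs leaving [u]; constant by [arc_const]. *)
pose P u := PX_arc (s u) (s (nx u)).
have PE u v : PX_arc u v -> P u = PX_arc (s u) (s v).
  by move=> uv; rewrite /P -!(path _ _ _ (pvP u)).
have Pc : forall u v, P u = P v.
  by apply: arc_const => u v uv; rewrite (PE _ _ uv) (path _ _ _ uv (nxP v)).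
pose o := win 0 (fun=> 0).
have [P0|nP0] := boolP (P o).
  exists ((s o).1 - o.1); left=> u.
  rewrite -(@arc_const _ (fun x => (s x).1 - x.1) _ u) 1?addrC ?subrK // => x y.
  move=> xy; have := P0; rewrite (Pc o x) (PE _ _ xy) => /arcP[-> _].
  by case/arcP: xy => -> _; rewrite opprD addrACA subrr addr0.
exists ((s o).1 + o.1); right=> u.
rewrite -(@arc_const _ (fun x => (s x).1 + x.1) _ u) ?addrK // => x y.
move=> xy; have := nP0; rewrite (Pc o x) (PE _ _ xy) => /negPf nxy.
have := sadj _ _ xy; rewrite /PX_adj nxy => /arcP[-> _].
by case/arcP: xy => -> _; rewrite addrAC addrA.
Qed.

Lemma bit_transport (s : {perm PX n k}) p p' : is_aut s ->
    (forall u, cov p u -> cov p' (s u)) ->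
  forall u v, cov p u -> cov p v -> bit p u = bit p v ->
    bit p' (s u) = bit p' (s v).
Proof.
move=> /is_autP sP pp'; apply: bit_dep => u v uv cu cv.
apply: adj_bit; rewrite ?pp' // -[PX_adj _ _]/(@adj (PX n k) _ _) sP /=.
by rewrite /PX_adj uv.
Qed.

(** A bit is determined by whether it equals the bit of the fixed vertex there, and both [s] and its
    inverse preserve this equality. *)
Lemma aut_fix (s : {perm PX n k}) : is_aut s ->
    (forall u, (s u).1 = u.1) -> (forall p, exists2 v, cov p v & s v = v) ->
  s = 1%g.
Proof.
move=> sa s1 fixs; apply/permP=> u; rewrite perm1.
apply: vertex_eq => // p cp; have [v cv sv] := fixs p.
have cu : cov p u by move: cp; rewrite /cov s1.
apply: (@Z2_eq _ _ (bit p v)); apply/eqP/eqP => e.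
  have sV x : ((s^-1)%g x).1 = x.1 by rewrite -{2}(permKV s x) s1.
  have cVp x : cov p x -> cov p ((s^-1)%g x) by rewrite /cov sV.
  have := bit_transport (is_autV sa) cVp cp cv e.
  by rewrite permK -{1}sv permK.
have cVp x : cov p x -> cov p (s x) by rewrite /cov s1.
by rewrite (bit_transport sa cVp cu cv e) sv.
Qed.

(** * The upper bound *)

Section UpperBound.

(** [d] tells whether the zero word at 0 is added; without it, the windows at [q * k] and 0 overlap
    in [k - r >= 2] positions. *)
Variables (q r : nat) (d : bool).
Hypotheses (nE : n = (q * k + r)%N) (r_gt0 : (0 < r)%N) (ltrk : (r < k)%N).
Hypothesis (d_r : d || (r.+1 < k)%N).

Definition flat (j : nat) : PX_vertex n k := win (j * k)%:R (fun=> 0).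
(** Its only 1 sits at position 0, where [flat q] has bit 0. *)
Definition spike : PX_vertex n k := win 0 (fun p => if p == 0 then 1 else 0).
Definition base : {set PX n k} :=
  spike |: ((if d then [set flat 0] else set0) :|: [set flat j.+1 | j : 'I_q]).

Lemma card_base : (#|base| <= q.+1 + d)%N.
Proof.
rewrite cardsU1; apply: (@leq_trans (1 + (d + q))); last by lia.
apply: leq_add; first exact: leq_b1.
apply: leq_trans (leq_card_setU _ _) _; apply: leq_add.
  by case: d; rewrite ?cards1 ?cards0.
by apply: leq_trans (leq_imset_card _ _) _; rewrite card_ord.
Qed.

Lemma baseP u : reflect
  [\/ u = spike, d /\ u = flat 0 | exists2 j, (0 < j <= q)%N & u = flat j]
  (u \in base).
Proof.
rewrite !inE; apply: (iffP or3P) => -[|h|h].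
- by move/eqP; constructor 1.
- by constructor 2; case: d h; rewrite inE // => /eqP.
- by constructor 3; case/imsetP: h => j _ ->; exists j.+1 => //=.
- by move->; constructor 1.
- by case: h => -> ->; constructor 2; rewrite inE.
- case: h => -[|j] //= jq ->; constructor 3.
  by apply/imsetP; exists (Ordinal jq).
Qed.

Lemma base_fst u : u \in base -> exists2 j, (j <= q)%N & u.1 = (j * k)%:R.
Proof.
case/baseP=> [->|[_ ->]|[j /andP[_ jq] ->]]; first by exists 0%N.
  by exists 0%N.
by exists j.
Qed.

Lemma start_inj (i j : nat) : (i <= q)%N -> (j <= q)%N ->
  (i * k)%:R = (j * k)%:R :> 'Z_n -> i = j.
Proof.
move=> iq jq /eqP; rewrite eq_natZ !modn_small; [|nia|nia].
by rewrite eqn_pmul2r => [/eqP|]; lia.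
Qed.

(** As [q * k] is [-r] in Z_n, for [i > 0] the left side is [i * k - r], and equality would make [k]
    divide [r]. This leaves only the trivial rotation and one reflection. *)
Lemma start_shift (i j : nat) : (i <= q)%N -> (j <= q)%N ->
  (q * k)%:R + (i * k)%:R = (j * k)%:R :> 'Z_n -> i = 0%N /\ j = q.
Proof.
move=> iq jq; rewrite -natrD => /eqP; rewrite eq_natZ.
case: i iq => [|i] iq.
  by rewrite addn0 -eq_natZ => /eqP /start_inj -> //.
have -> : (q * k + i.+1 * k = n + (i * k + (k - r)))%N by nia.
rewrite modnDl !modn_small; [|nia|nia] => /eqP h.
have : (k %| r)%N.
  rewrite -(@dvdn_addr (j * k)) ?dvdn_mull // -h -addnA subnK; last exact: ltnW.
  by rewrite dvdn_add ?dvdn_mull.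
by move=> /dvdn_leq; lia.
Qed.

Lemma start_neq0 (j : nat) : (0 < j <= q)%N -> (j * k)%:R <> 0 :> 'Z_n.
Proof. by case/andP=> j0 jq /(@start_inj j 0 jq isT) j_0; rewrite j_0 in j0. Qed.

Lemma fst_flat u (j : nat) : (0 < j <= q)%N -> u \in base -> u.1 = (j * k)%:R ->
  u = flat j.
Proof.
move=> /andP[j0 jq] /baseP[->|[_ ->]|[i /andP[i0 iq] ->]] /=; last first.
- by move/start_inj->.
- by move/start_inj=> h; move: j0; rewrite -h.
- by move/(@start_inj 0)=> h; move: j0; rewrite -h.
Qed.

Lemma base_distinguishing :
  distinguishing ([ffun u => u \in base] : coloring (PX n k)).
Proof.
apply/forallP=> s; apply/implyP=> /andP[sa /preservesP sc]; apply/eqP.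
have sb u : u \in base -> s u \in base.
  by move=> ub; have := sc u; rewrite !ffunE ub.
have q_gt0 : (0 < q)%N by nia.
have spike_b : spike \in base by apply/baseP; constructor 1.
have flat_b (j : nat) : (0 < j <= q)%N -> flat j \in base.
  by move=> jq; apply/baseP; constructor 3; exists j.
have qq : (0 < q <= q)%N by rewrite q_gt0 /=.
have n0 : (q * k)%:R + r%:R = 0 :> 'Z_n by rewrite -natrD -nE pchar_Zp.
have [i iq iE] := base_fst (sb _ spike_b).
have [j jq jE] := base_fst (sb _ (flat_b _ qq)).
have cov0 : cov 0 (flat q).
  by rewrite /cov (@off_eq _ _ r) //; lia.
have cov0s : cov 0 spike by rewrite /cov (@off_eq _ _ 0) ?addr0 //; lia.
have flat0 (x : nat) p : cov p (flat x) -> bit p (flat x) = 0 by move=> ?; rewrite bit_win.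
have spike0 : bit 0 spike = 1 by rewrite bit_win.
have [c [sE|sE]] := aut_fst sa; rewrite sE /= in iE; rewrite sE /= in jE.
  move: iE; rewrite add0r => cE; rewrite cE in jE.
  have [i0 _] := start_shift iq jq jE.
  have s1 u : (s u).1 = u.1 by rewrite sE cE i0 addr0.
  have sflat (x : nat) : (0 < x <= q)%N -> s (flat x) = flat x.
    by move=> xq; apply: fst_flat; rewrite ?sb ?flat_b ?s1.
  apply: (aut_fix sa s1) => p.
  (* With [x] the quotient of [p] by [k], the fixed vertex covering [p] is [flat x], or [spike] if
     [x = 0]. *)
  have pn := off_lt p 0.
  have xq : (off p 0 %/ k <= q)%N.
    by rewrite -ltnS ltn_divLR; nia.
  have px : (off p (off p 0 %/ k * k)%:R < k)%N.
    rewrite (@off_eq _ _ (off p 0 %% k)); first by rewrite ltn_mod; lia.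
      by apply: leq_ltn_trans (leq_mod _ _) _.
    by rewrite -natrD -divn_eq -[RHS]add0r offK.
  case: (posnP (off p 0 %/ k)) (xq) px => [->|x0] {}xq px; last first.
    by exists (flat (off p 0 %/ k)); rewrite // sflat // x0.
  exists spike => //.
  case/baseP: (sb _ spike_b) => [//|[dT sF]|[x xq' sF]]; last first.
    by have := congr1 fst sF; rewrite s1 => /esym/(start_neq0 xq').
  (* If [spike] went to [flat 0], then [flat 0] would have to go to [spike]; but the fixed [flat q]
     shows that bit 0 at position 0 is kept. *)
  have F_b : flat 0 \in base by apply/baseP; constructor 2.
  have cF : cov 0 (flat 0) by [].
  have cs u : cov 0 u -> cov 0 (s u) by rewrite /cov s1.
  have := bit_transport sa cs cF cov0; rewrite !flat0 // (sflat q) // flat0 //.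
  move/(_ erefl) => h0.
  case/baseP: (sb _ F_b) => [sF'|[_ sF']|[x xq' sF']].
  - by move: h0; rewrite sF' spike0.
  - have := perm_inj (etrans sF (esym sF')) => /(congr1 (bit 0)).
    by rewrite spike0 flat0.
  - by have := congr1 fst sF'; rewrite s1 => /esym/(start_neq0 xq').
exfalso.
have jE' : (q * k)%:R + (j * k)%:R = (i * k)%:R :> 'Z_n by rewrite -jE -iE; ring.
have {jE'} [j0 iq'] := start_shift jq iq jE'; subst i j.
have cE : c = (q * k)%:R by rewrite -iE subr0.
have sspike : s spike = flat q by apply: fst_flat; rewrite ?sb // sE iE.
case: (boolP d) => [dT|dF].
  have F_b : flat 0 \in base by apply/baseP; constructor 2.
  have sF : s (flat 0) = flat q.
    by apply: fst_flat; rewrite ?sb // sE /= cE mul0n subr0.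
  have := perm_inj (etrans sspike (esym sF)) => /(congr1 (bit 0)).
  by rewrite spike0 flat0.
have sq : s (flat q) = spike.
  have := sb _ (flat_b _ qq) => /baseP[//|[dT _]|[x xq' sF]].
    by rewrite dT in dF.
  by have := congr1 fst sF; rewrite sE /= jE => /esym/(start_neq0 xq').
(* The reflection carries this position to 0. It is nonzero, so [spike] and [flat q] agree there,
   while their images differ at 0. *)
pose p : 'Z_n := (k - r).-1%:R.
have cp u : cov p u -> cov 0 (s u).
  rewrite /cov sE => cu; rewrite (@off_eq _ _ (k.-1 - off p u.1)); try lia.
  rewrite cE natrB; last by lia.
  have {1}-> : u.1 = p - (off p u.1)%:R by rewrite -{1}(offK p u.1) addrK.
  suff -> : k.-1%:R = p + r%:R :> 'Z_n.
    rewrite -[LHS]n0; ring.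
  by rewrite -natrD; congr _%:R; lia.
have cps : cov p spike.
  by rewrite /cov /= (@off_eq _ _ (k - r).-1) ?add0r //; lia.
have cpq : cov p (flat q).
  rewrite /cov /= (@off_eq _ _ k.-1) //; try lia.
  by rewrite -[LHS]add0r -n0 -addrA -natrD; congr (_ + _%:R); lia.
have := bit_transport sa cp cps cpq; rewrite sspike sq spike0 flat0 //.
rewrite bit_win // ifF ?flat0 //.
  by move/(_ erefl).
apply/negP; rewrite (eq_natZ _ 0) !modn_small; lia.
Qed.

End UpperBound.

(** * The lower bound *)

(** Adding the same [f p] to both bits at a common position keeps their agreement, so arcs are all
    kept or all reversed, according to [si]. *)
Lemma twist_aut (si pi : 'Z_n -> 'Z_n) (f : 'Z_n -> 'Z_2) :
    involutive si -> involutive pi ->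
    (forall p i, (off p i < k)%N -> (off (pi p) (si i) < k)%N) ->
    (forall i, si (i + 1) = si i + 1) \/ (forall i, si (i + 1) = si i - 1) ->
  exists s : {perm PX n k}, [/\ is_aut s, forall u, (s u).1 = si u.1 &
    forall p u, cov p u -> bit (pi p) (s u) = bit p u + f p].
Proof.
move=> siK piK picov si1.
pose F (u : PX n k) : PX n k :=
  win (si u.1) (fun p => bit (pi p) u + f (pi p)).
have Fcov p u : cov p u -> cov (pi p) (F u) by rewrite /cov; apply: picov.
have Fbit p u : cov p u -> bit (pi p) (F u) = bit p u + f p.
  by move=> cu; rewrite bit_win ?piK //; apply: Fcov cu.
have covF p u : cov (pi p) (F u) -> cov p u.
  by move=> /picov; rewrite piK siK.
have Finj : injective F.
  move=> u v e.
  have e1 : u.1 = v.1 by have /(congr1 si) := congr1 fst e; rewrite !siK.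
  apply: vertex_eq => // p cu; apply: (addIr (f p)).
  by rewrite -!Fbit ?e // /cov -e1.
have Farc (u v : PX n k) :
  (forall p, cov p u -> cov p v -> bit p u = bit p v) <->
  (forall p, cov p (F u) -> cov p (F v) -> bit p (F u) = bit p (F v)).
  split=> h p cu cv.
    by rewrite -(piK p) in cu cv *; rewrite !Fbit ?h //; apply: covF.
  by apply: (addIr (f p)); rewrite -!Fbit ?h //; apply: Fcov.
exists (perm Finj); split=> [|u|p u cu]; rewrite ?permE ?Fbit //.
apply/is_autP=> u v; rewrite !permE /= /PX_adj.
case: si1 => si1.
  suff E x y : PX_arc (F x) (F y) = PX_arc x y by rewrite !E.
  apply/idP/idP=> /arcP[e h]; apply/arcP; split.
  - by apply: (can_inj siK); rewrite si1; apply: e.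
  - exact: (iffRL (Farc x y)).
  - by rewrite /= e si1.
  - exact: (iffLR (Farc x y)).
suff E x y : PX_arc (F x) (F y) = PX_arc y x by rewrite !E orbC.
apply/idP/idP=> /arcP[e h]; apply/arcP; split.
- by apply: (can_inj siK); rewrite si1 -[si x.1](addrK 1); congr (_ - _).
- by move=> p cy cx; apply/esym; move: p cx cy; apply: (iffRL (Farc x y)).
- by rewrite /= e si1 subrK.
- by apply: (iffLR (Farc x y)) => p cx cy; rewrite h.
Qed.

Section LowerBound.

Variables (c : coloring (PX n k)) (b : bool).
Hypothesis c_dist : distinguishing c.

Let S := color_class c b.

(** By finiteness [s] maps [S] onto itself, hence also preserves the other class. *)
Lemma class_fix (s : {perm PX n k}) :
  is_aut s -> (forall u, u \in S -> s u \in S) -> s = 1%g.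
Proof.
move=> sa sS; have /forallP/(_ s) := c_dist; rewrite sa /=.
suff -> : preserves s c by move/eqP.
have sSE : s @: S = S.
  apply/eqP; rewrite eqEcard card_imset ?leqnn ?andbT; last exact: perm_inj.
  by apply/subsetP=> _ /imsetP[u uS ->]; apply: sS.
apply/preservesP=> u; have : (s u \in S) = (u \in S).
  by rewrite -{1}sSE mem_imset //; apply: perm_inj.
by rewrite !inE; case: (c u) (c (s u)) b => [] [] [].
Qed.

Lemma class_cov p : exists2 s, s \in S & cov p s.
Proof.
apply/exists_inP; apply: contraT => /exists_inPn noS.
(* The automorphism flipping only the bit at [p]. *)
have [|||//|s [sa s1 sb]] :=
  @twist_aut id id (fun x => if x == p then 1 else 0) _ _ _ _; try by [].
  by left.
have s_id : s = 1%g.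
  apply: class_fix => // u uS; suff -> : s u = u by [].
  apply: vertex_eq => // x; rewrite /cov s1 => xu.
  rewrite (sb x) // ifF ?addr0 //; apply: contraTF xu => /eqP ->.
  exact: noS.
have cp : cov p (win p (fun=> 0)) by rewrite /cov (@off_eq _ _ 0) ?addr0 //; lia.
by have := sb p _ cp; rewrite s_id perm1 eqxx bit_win.
Qed.

Definition mult p : nat := #|[set s in S | cov p s]|.

Lemma card_cov u : #|[set p | cov p u]| = k.
Proof.
have -> : [set p | cov p u] = [set u.1 + (val j)%:R | j : 'I_k].
  apply/setP=> p; rewrite inE; apply/idP/imsetP => [h | [j _ ->]].
    by exists (Ordinal h); rewrite //= offK.
  have jk := ltn_ord j; rewrite /cov off_add //; apply: leq_trans jk _; lia.
rewrite card_imset ?card_ord // => i j /addrI /eqP.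
rewrite eq_natZ !modn_small => [/eqP/val_inj //||];
  by have := ltn_ord i; have := ltn_ord j; rewrite /=; lia.
Qed.

Lemma sum_mult : (\sum_p mult p = #|S| * k)%N.
Proof.
rewrite (eq_bigr (fun p => \sum_(s in S | cov p s) 1)%N) => [|p _]; last first.
  by rewrite /mult -sum1_card; apply: eq_bigl => s; rewrite inE.
rewrite (exchange_big_dep (mem S)) /= => [|p s _ /andP[]//].
rewrite -sum_nat_const; apply: eq_bigr => s sS.
by rewrite -[RHS](card_cov s) -sum1_card; apply: eq_bigl => p; rewrite inE sS.
Qed.

Lemma mult_gt0 p : (0 < mult p)%N.
Proof.
by have [s sS cs] := class_cov p; apply/card_gt0P; exists s; rewrite inE sS.
Qed.

Lemma sum1_Zn : (\sum_(p : 'Z_n) 1 = n)%N.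
Proof. by rewrite sum1_card card_ord Zp_cast. Qed.

Lemma class_ge : (n <= #|S| * k)%N.
Proof.
by rewrite -sum_mult -[X in (X <= _)%N]sum1_Zn leq_sum // => p _; apply: mult_gt0.
Qed.

(** The excesses [(mult p).-1] sum to [n + 1 - n = 1]. *)
Lemma double_position : (#|S| * k = n.+1)%N ->
  exists2 p0, mult p0 = 2 & forall p, p != p0 -> mult p = 1%N.
Proof.
rewrite -sum_mult => sumE.
have sum1 : (\sum_p (mult p).-1 = 1)%N.
  suff : (\sum_p (mult p).-1 + n = n.+1)%N by lia.
  rewrite -sumE -[X in (_ + X = _)%N]sum1_Zn -big_split /=.
  by apply: eq_bigr => p _; rewrite addn1 prednK ?mult_gt0.
have [p0 p0P] : exists p0, (0 < (mult p0).-1)%N.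
  apply/existsP; apply: contraT => /existsPn no.
  by rewrite big1 // in sum1 => p _; have := no p; case: (_.-1).
rewrite (bigD1 p0) //= in sum1.
have [mult2 /eqP b0] : mult p0 = 2 /\ (\sum_(p | p != p0) (mult p).-1 = 0)%N.
  by move: p0P sum1; move: (mult p0) (\sum_(_ | _) _)%N => x y; lia.
exists p0 => //; move: b0; rewrite sum_nat_eq0 => /forall_inP h p /h; have := mult_gt0 p.
by case: (mult p) => [|[]].
Qed.

(* A class of [m] vertices with [m * k = n + 1] starts at the positions
   [p0 + j k], [j < m], where [p0] is the only position covered twice; the
   reflection about [p0], followed by suitable bit flips, preserves it. *)
Lemma class_neq : (#|S| * k)%N <> n.+1.
Proof.
set m := #|S| => mk.
have [p0 mult2 mult1] := double_position mk.
have uniq1 p s t : p != p0 -> s \in S -> t \in S -> cov p s -> cov p t -> s = t.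
  move=> /mult1/eqP/cards1P[x xE] sS tS cs ct.
  have : s \in [set s in S | cov p s] by rewrite inE sS.
  have : t \in [set s in S | cov p s] by rewrite inE tS.
  by rewrite xE !inE => /eqP -> /eqP.
have n0 : n%:R = 0 :> 'Z_n by rewrite pchar_Zp.
(* If neither vertex covering [p0] started there, both would cover [p0 - 1], which is covered
   once. *)
have start0 : exists2 s, s \in S & s.1 = p0.
  move: mult2 => /eqP/cards2P[s [t [st E]]].
  have [sS cs] : s \in S /\ cov p0 s.
    by apply/andP; have := set21 s t; rewrite -E inE.
  have [tS ct] : t \in S /\ cov p0 t.
    by apply/andP; have := set22 s t; rewrite -E inE.
  have [s0|s0] := posnP (off p0 s.1).
    by exists s => //; rewrite -(offK p0 s.1) s0 addr0.
  have [t0|t0] := posnP (off p0 t.1).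
    by exists t => //; rewrite -(offK p0 t.1) t0 addr0.
  have back (x : PX n k) : cov p0 x -> (0 < off p0 x.1)%N -> cov (p0 - 1) x.
    rewrite /cov => cx x0; rewrite (@off_eq _ _ (off p0 x.1).-1); try lia.
    by apply: (addIr 1); rewrite subrK -addrA natr1 prednK ?offK.
  case/eqP: st; apply: (@uniq1 (p0 - 1)); rewrite ?back //.
  by rewrite -subr_eq0 addrAC subrr add0r oppr_eq0 oner_eq0.
(* A vertex covering the position just after [s] starts there, or it would share with [s] the last
   position of [s]. *)
have next s : s \in S -> s.1 + k.-1%:R != p0 ->
    exists2 t, t \in S & t.1 = s.1 + k%:R.
  move=> sS sp0; have [t tS ct] := class_cov (s.1 + k%:R).
  have [t0|t0] := posnP (off (s.1 + k%:R) t.1).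
    by exists t => //; rewrite -(offK (s.1 + k%:R) t.1) t0 addr0.
  have e : s = t.
    apply: (uniq1 _ _ _ sp0) => //; rewrite /cov.
      by rewrite off_add; lia.
    rewrite /cov in ct; rewrite (@off_eq _ _ (off (s.1 + k%:R) t.1).-1); try lia.
    apply: (addIr 1); rewrite -!addrA !natr1 !prednK ?offK //; lia.
  by move: ct; rewrite -e /cov off_add ?ltnn //; lia.
have starts (j : nat) : (j < m)%N -> exists2 s, s \in S & s.1 = p0 + (j * k)%:R.
  elim: j => [|j IH] jm; first by rewrite mul0n addr0.
  have [s sS s1] := IH (ltnW jm).
  have [|t tS t1] := next s sS.
    rewrite s1 -addrA -natrD -subr_eq0 addrAC subrr add0r (eq_natZ _ 0).
    by rewrite !modn_small; nia.
  by exists t => //; rewrite t1 s1 -addrA -natrD mulSn addnC.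
pose st (j : nat) := odflt (win 0 (fun=> 0)) [pick s in S | s.1 == p0 + (j * k)%:R].
have stP (j : nat) : (j < m)%N -> st j \in S /\ (st j).1 = p0 + (j * k)%:R.
  move=> /starts[s sS s1]; rewrite /st.
  case: pickP => [x /andP[? /eqP] //|/(_ s)].
  by rewrite inE in sS *; rewrite sS s1 eqxx.
have st_inj (i j : nat) : (i < m)%N -> (j < m)%N -> st i = st j -> i = j.
  move=> im jm /(congr1 fst); rewrite (proj2 (stP _ im)) (proj2 (stP _ jm)).
  by move=> /addrI/eqP; rewrite eq_natZ !modn_small; nia.
have SE s : s \in S -> exists2 j : nat, (j < m)%N & s = st j.
  suff -> : S = [set st (val j) | j : 'I_m].
    by case/imsetP=> j _ ->; exists j.
  apply/esym/eqP; rewrite eqEcard card_imset ?card_ord ?leqnn ?andbT.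
    by apply/subsetP=> _ /imsetP[j _ ->]; case: (stP j (ltn_ord j)).
  by move=> i j /(st_inj _ _ (ltn_ord i) (ltn_ord j))/val_inj.
pose pi p := p0 + p0 - p.
(* The reflected window starts at the image of its last position, hence [k.-1]. *)
pose si i := p0 + p0 - k.-1%:R - i.
pose f p := let j := (off p p0 %/ k)%N in
  bit (pi p) (st (m - j.+1)%N) - bit p (st j).
have siK : involutive si by move=> i; rewrite /si; ring.
have piK : involutive pi by move=> i; rewrite /pi; ring.
have cov_pi p i : (off p i < k)%N -> (off (pi p) (si i) < k)%N.
  move=> h; rewrite (@off_eq _ _ (k.-1 - off p i)); try lia.
  rewrite natrB; last by lia.
  by rewrite /pi /si -{1}(offK p i); ring.
have [|s [sa s1 sb]] := twist_aut f siK piK cov_pi.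
  by right=> i; rewrite /si; ring.
have sst (j : nat) : (j < m)%N -> s (st j) = st (m - j.+1)%N.
  move=> jm; have jm' : (m - j.+1 < m)%N by lia.
  have [_ e1] := stP _ jm; have [_ e2] := stP _ jm'.
  apply: vertex_eq => [|p'].
    rewrite s1 e1 e2 /si.
    suff : ((m - j.+1) * k)%:R + (j * k)%:R + k.-1%:R = 0 :> 'Z_n.
      by move=> e; apply/eqP; rewrite -subr_eq0 -oppr_eq0 -e; apply/eqP; ring.
    by rewrite -!natrD -n0; congr _%:R; nia.
  rewrite /cov s1 => /cov_pi; rewrite siK -{2 3}(piK p').
  move: (pi p') => p {p'} cp; rewrite sb //.
  set a := off p (st j).1 in cp.
  have pE : p = p0 + (j * k + a)%:R by rewrite natrD addrA -e1 offK.
  have [ja|ja] := ltnP (j * k + a) n.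
    rewrite /f (@off_eq _ _ (j * k + a)) // divnMDl ?divn_small //; last by lia.
    by rewrite addn0 addrC subrK.
  (* The last position of [st m.-1] is [p0] again, where [f] was chosen for [st 0]; both demands
     agree because twice a bit is 0. *)
  have [jE aE] : j = m.-1 /\ (j * k + a = n)%N by nia.
  have pp0 : p = p0 by rewrite pE aE n0 addr0.
  have pi0 : pi p0 = p0 by rewrite /pi addrK.
  have off0 : off p0 p0 = 0%N by apply: off_eq; [lia | rewrite addr0].
  rewrite /f pp0 off0 div0n pi0 jE subn1 prednK; last by lia.
  by rewrite subnn; case: (bit p0 _) (bit p0 _) => [[|[|?]] ?] [[|[|?]] ?] //;
    apply: val_inj.
have s_id : s = 1%g.
  apply: class_fix => // u /SE[j jm ->]; rewrite sst //.
  by have [] := stP (m - j.+1)%N; first by lia.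
(* So the reflection exchanges the distinct vertices [st 0] and [st m.-1]. *)
have m_gt2 : (2 < m)%N by nia.
have := sst 0%N; rewrite s_id perm1 => /(_ (ltnW (ltnW m_gt2))).
by move/st_inj; lia.
Qed.

End LowerBound.

End Windows.

(** * Combining the two bounds *)

Theorem theorem6p5 (n k : nat) (hk : (2 <= k)%N) (hn : (2 * k < n)%N)
    (hkn : ~~ (k %| n)%N) :
  exists h : two_distinguishable (PX n k),
    (rho h)%:Z =
      if (n%:Z == -1 %[mod k%:Z])%Z then Num.ceil (n%:Q / k%:Q) + 1
      else Num.ceil (n%:Q / k%:Q).
Proof.
pose q := (n %/ k)%N; pose r := (n %% k)%N; pose d := r.+1 == k.
have nE : n = (q * k + r)%N by rewrite -divn_eq.
have r_gt0 : (0 < r)%N by rewrite lt0n.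
have ltrk : (r < k)%N by rewrite ltn_mod; lia.
have d_r : d || (r.+1 < k)%N by rewrite -leq_eqVlt.
pose c0 : coloring (PX n k) := [ffun u => u \in base n k q d].
have dist : distinguishing c0 := base_distinguishing hk hn nE r_gt0 ltrk d_r.
have h : two_distinguishable (PX n k) by apply/existsP; exists c0.
exists h.
have -> : rho h = (q.+1 + d)%N.
  rewrite /rho; case: ex_minnP => m /existsP[c /andP[cd /existsP[b /eqP mE]]].
  move=> m_min; apply/eqP; rewrite eqn_leq; apply/andP; split.
    apply: leq_trans (m_min _ _) (card_base hk hn nE r_gt0 ltrk d_r).
    apply/existsP; exists c0; rewrite dist; apply/existsP; exists true.
    apply/eqP; congr #|pred_of_set _|; apply/setP=> u.
    by rewrite !inE ffunE !inE.
  have := @class_ge _ _ hk hn c b cd; have := @class_neq _ _ hk hn c b cd; rewrite mE.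
  move=> neq ge; have ltqm : (q < m)%N.
    by rewrite -(@ltn_pmul2r k); lia.
  rewrite /d; case: eqP => [rk|_] /=; last by rewrite addn0.
  (* For [r = k - 1], a class of size [q + 1] would give [m * k = n + 1]. *)
  rewrite addn1 ltn_neqAle ltqm andbT; apply/eqP=> qm; apply: neq.
  by rewrite -qm mulSn; lia.
have k_gt0 : 0 < k%:Q by rewrite ltr0n; lia.
have -> : Num.ceil (n%:Q / k%:Q) = q.+1%:Z.
  apply: ceil_def; rewrite ltr_pdivlMr // ler_pdivrMr //.
  have -> : q.+1%:Z - 1 = q%:Z by lia.
  rewrite -!intrM -!PoszM ltr_int ler_int.
  by apply/andP; split; lia.
(* The congruence says that [k] divides [r + 1], and [0 < r + 1 <= k]. *)
have -> : (n%:Z == -1 %[mod k%:Z])%Z = d.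
  rewrite eqz_mod_dvd opprK -PoszD dvdzE /= addn1 /d.
  rewrite nE -addnS dvdn_addr ?dvdn_mull //.
  apply/idP/eqP => [/dvdn_leq|->] //; lia.
by move: (d) => [] /=; rewrite ?addn0 ?PoszD.
Qed.
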